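(* Let $F(\alpha,\beta)=\sum_{m\ge0}\frac{\alpha^m\beta^{\binom m2}}{m!}$. Then, as formal power series, \[ 1+\sum_{n\ge 1}\sum_{d\ge 2} f_{d-2}(\Sigma_{n,n})\,\frac{x^d}{d!}\,\frac{y^n}{n!}=\frac{F(x,e^y)}{e^x}, \] where $f_i(\Sigma_{n,n})$ is the number of $i$-dimensional cones of the bipermutahedral fan $\Sigma_{n,n}$.
   Context: Let $N_n=\mathbb{R}^n/\mathbb{R}(1,\dots,1)$. For $S\subseteq[n]$ let $\mathsf{e}_S$ (resp. $\mathsf{f}_S$) denote the image in the first (resp. second) factor of $N_n\times N_n$ of the indicator vector of $S$. A bipermutation of $[n]$ is a sequence $b_1|\cdots|b_{2n-1}$ of elements of $[n]$ in which one element appears exactly once and every other element exactly twice. The bipermutahedral fan $\Sigma_{n,n}$ is the complete simplicial fan in $N_n\times N_n$ whose maximal cones are, for each bipermutation $\mathsf{B}=b_1|\cdots|b_{2n-1}$, the cones $\mathrm{cone}\{\mathsf{e}_{\{b_1,\dots,b_m\}}+\mathsf{f}_{\{b_{m+1},\dots,b_{2n-1}\}}:1\le m\le 2n-2\}$, together with all their faces. (For $n=1$, $N_1=0$ and $\Sigma_{1,1}$ consists of the single zero-dimensional cone.) $f_i(\Sigma_{n,n})=0$ when $i>2n-2$. *)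

(* Defs.v *)
From HB Require Import structures.
From mathcomp Require Import all_boot all_order all_algebra.
From mathcomp Require Import generic_quotient ring_quotient.
From mathcomp Require Import finmap.
From mathcomp Require Import mathcomp_extra boolp classical_sets functions.
From mathcomp Require Import cardinality reals.

Set Implicit Arguments.
Unset Strict Implicit.
Unset Printing Implicit Defensive.

Import Order.TTheory GRing.Theory Num.Theory.

Local Open Scope ring_scope.

(* Iterating the construction, [fps (fps A)] is the ring A[[y]][[x]]: the
   outer index is the exponent of x, the inner one the exponent of y. *)
Record fps (A : Type) := FPS { coefs :> nat -> A }.

HB.instance Definition _ (A : Type) := gen_eqMixin (fps A).
HB.instance Definition _ (A : Type) := gen_choiceMixin (fps A).

Lemma fpsP (A : Type) (f g : fps A) : (forall n, f n = g n) -> f = g.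
Proof. by case: f g => [f] [g] /= /funext ->. Qed.

Section FpsRing.
Variable A : comNzRingType.
Implicit Types f g h : fps A.

Definition fps_zero : fps A := FPS (fun=> 0).
Definition fps_opp f : fps A := FPS (fun n => - f n).
Definition fps_add f g : fps A := FPS (fun n => f n + g n).
Definition fps_one : fps A := FPS (fun n => (n == 0%N)%:R).
Definition fps_mul f g : fps A := FPS (fun n => \sum_(i < n.+1) f i * g (n - i)%N).

Fact fps_addA : associative fps_add.
Proof. by move=> f g h; apply: fpsP => n /=; rewrite addrA. Qed.
Fact fps_addC : commutative fps_add.
Proof. by move=> f g; apply: fpsP => n /=; rewrite addrC. Qed.
Fact fps_add0 : left_id fps_zero fps_add.
Proof. by move=> f; apply: fpsP => n /=; rewrite add0r. Qed.
Fact fps_addN : left_inverse fps_zero fps_opp fps_add.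
Proof. by move=> f; apply: fpsP => n /=; rewrite addNr. Qed.

HB.instance Definition _ :=
  GRing.isZmodule.Build (fps A) fps_addA fps_addC fps_add0 fps_addN.

Let trunc N f : {poly A} := \poly_(i < N.+1) f i.

Let trunc_mul N f g n : (n <= N)%N ->
  fps_mul f g n = (trunc N f * trunc N g)`_n.
Proof.
move=> nN; rewrite coefM /=; apply: eq_bigr => i _; rewrite !coef_poly.
have iN : (i < N.+1)%N by rewrite ltnS (leq_trans _ nN) // -ltnS.
by rewrite iN ltnS (leq_trans (leq_subr _ _) nN).
Qed.

Fact fps_mulA : associative fps_mul.
Proof.
move=> f g h; apply: fpsP => n.
transitivity ((trunc n f * (trunc n g * trunc n h))`_n).
  rewrite coefM /=; apply: eq_bigr => i _.
  by rewrite -(trunc_mul (N := n)) ?leq_subr// coef_poly ltn_ord.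
rewrite mulrA coefM /=; apply: eq_bigr => i _.
have iN : (i <= n)%N by rewrite -ltnS.
rewrite -(trunc_mul (N := n))//.
by rewrite coef_poly ltnS leq_subr.
Qed.
Fact fps_mulC : commutative fps_mul.
Proof.
move=> f g; apply: fpsP => n.
by rewrite !(trunc_mul (N := n))// mulrC.
Qed.
Fact fps_mul1 : left_id fps_one fps_mul.
Proof.
move=> f; apply: fpsP => n /=.
rewrite big_ord_recl /= subn0 mul1r big1 ?addr0 // => i _.
by rewrite mul0r.
Qed.
Fact fps_mulDl : left_distributive fps_mul fps_add.
Proof.
move=> f g h; apply: fpsP => n /=; rewrite -big_split /=.
by apply: eq_bigr => i _; rewrite mulrDl.
Qed.
Fact fps_one_neq0 : fps_one != 0.
Proof.
apply/eqP => /(congr1 (fun f : fps A => f 0%N)) /= /eqP.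
by rewrite oner_eq0.
Qed.

HB.instance Definition _ := GRing.Zmodule_isComNzRing.Build (fps A)
  fps_mulA fps_mulC fps_mul1 fps_mulDl fps_one_neq0.

Lemma fps0E n : (0 : fps A) n = 0. Proof. by []. Qed.
Lemma fpsNE f n : (- f) n = - f n. Proof. by []. Qed.
Lemma fpsDE f g n : (f + g) n = f n + g n. Proof. by []. Qed.
Lemma fps1E n : (1 : fps A) n = (n == 0%N)%:R. Proof. by []. Qed.
Lemma fpsME f g n : (f * g) n = \sum_(i < n.+1) f i * g (n - i)%N.
Proof. by []. Qed.
Lemma fps_sumE (I : Type) (r : seq I) (P : pred I) (F : I -> fps A) n :
  (\sum_(i <- r | P i) F i) n = \sum_(i <- r | P i) F i n.
Proof. by apply: (big_morph (fun f : fps A => f n)). Qed.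

Definition fpsC (a : A) : fps A := FPS (fun n => if n is 0%N then a else 0).

Lemma fpsCME a f n : (fpsC a * f) n = a * f n.
Proof.
rewrite fpsME big_ord_recl /= subn0 big1 ?addr0 // => i _.
by rewrite mul0r.
Qed.

Lemma fps_exprlt f n k : f 0%N = 0 -> (n < k)%N -> (f ^+ k) n = 0.
Proof.
move=> f0; elim: k n => // k IHk n; rewrite ltnS => nk.
rewrite exprS fpsME big1 // => -[[|i] /= iN] _; first by rewrite f0 mul0r.
rewrite IHk ?mulr0 //; apply: leq_trans nk.
by rewrite ltn_subrL /=; move: iN; rewrite ltnS; apply: leq_trans.
Qed.

End FpsRing.

Section FpsUnitRing.
Variable A : comUnitRingType.
Implicit Types f g h : fps A.

Definition fps_unit : {pred fps A} := [pred f : fps A | f 0%N \is a GRing.unit].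

(* f^-1 = a^-1 * \sum_k u ^ k  where a = f 0 and u = 1 - a^-1 f has zero
   constant term, so that only k <= n contribute to the n-th coefficient. *)
Definition fps_inv f : fps A :=
  if f \in fps_unit then
    let u := 1 - fpsC (f 0%N)^-1 * f in
    FPS (fun n => (f 0%N)^-1 * (\sum_(k < n.+1) u ^+ k) n)
  else f.

Fact fps_mulVx : {in fps_unit, left_inverse 1 fps_inv *%R}.
Proof.
move=> f fU; rewrite /fps_inv fU; set u := 1 - _.
have fU0 : f 0%N \is a GRing.unit by [].
have u0 : u 0%N = 0 by rewrite fpsDE fpsNE fpsCME mulVr // subrr.
apply: fpsP => n.
transitivity (((\sum_(k < n.+1) u ^+ k) * (1 - u)) n); last first.
  rewrite mulrC -opprB mulNr -subrX1 opprB fpsDE fpsNE.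
  by rewrite (fps_exprlt u0) // subr0.
have -> : 1 - u = fpsC (f 0%N)^-1 * f by rewrite /u opprB addrC subrK.
rewrite mulrCA fpsCME !fpsME mulr_sumr; apply: eq_bigr => -[i /= iN] _.
rewrite -mulrA; congr (_ * (_ * _)); rewrite !fps_sumE.
rewrite -(big_mkord xpredT (fun k => (u ^+ k) i)).
rewrite -[RHS](big_mkord xpredT (fun k => (u ^+ k) i)).
rewrite (big_cat_nat (n := i.+1) _ iN) //= [X in _ = _ + X]big_nat_cond.
rewrite [X in _ = _ + X]big1 ?addr0 // => k /andP[/andP[ik _] _].
by rewrite fps_exprlt.
Qed.
Fact fps_unitPl f g : g * f = 1 -> fps_unit f.
Proof.
move=> /(congr1 (fun h : fps A => h 0%N)).
rewrite fpsME big_ord_recl big_ord0 addr0 /= => gf.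
by apply/unitrP; exists (g 0%N); split; rewrite // mulrC.
Qed.
Fact fps_inv_out : {in [predC fps_unit], fps_inv =1 id}.
Proof. by move=> f; rewrite /fps_inv inE /= => /negPf ->. Qed.

HB.instance Definition _ := GRing.ComNzRing_hasMulInverse.Build (fps A)
  fps_mulVx fps_unitPl fps_inv_out.

Definition fps_exp : fps A := FPS (fun n => (n`!%:R)^-1).

End FpsUnitRing.

(* [fps_eval f g] is f(x, g), for f in A[beta][[alpha]] and g in A[[y]]:
   alpha becomes the outer variable x, and the polynomial in beta in front of
   alpha^m is evaluated at the series g, so g may have a constant term. *)
Definition fps_eval (A : comNzRingType) (f : fps {poly A}) (g : fps A) :
  fps (fps A) := FPS (fun m => (map_poly (@fpsC A) (f m)).[g]).

(* F(alpha, beta), with outer variable alpha and coefficients in Q[beta]. *)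
Definition F_series : fps {poly rat} :=
  FPS (fun m => (m`!%:R)^-1 *: 'X^('C(m, 2))).

Section Nspace.
Variables (R : realFieldType) (n : nat).

Definition diagonal : {vspace 'rV[R]_n} := <[const_mx 1]>%VS.

Definition Nspace : Type := Quotient.quot (pred_of_vspace diagonal).

HB.instance Definition _ := EqQuotient.on Nspace.
HB.instance Definition _ := GRing.Zmodule.on Nspace.

Definition toN (v : 'rV[R]_n) : Nspace := \pi_Nspace%qT v.

Lemma toN_eq u v : (toN u = toN v) <-> (u - v \in diagonal).
Proof.
have H := Quotient.idealrBE (pred_of_vspace diagonal) u v.
by split=> [E|E]; [rewrite H; apply/eqP | apply/eqP; rewrite -H].
Qed.

Lemma toN_repr x : toN (repr x) = x.
Proof. exact: reprK. Qed.

Lemma toND u v : toN (u + v) = toN u + toN v.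
Proof. by rewrite /toN; apply: (@Quotient.pi_add _ _ u v). Qed.

Definition Nscale (a : R) (x : Nspace) : Nspace := toN (a *: repr x).

Lemma NscaleE a v : Nscale a (toN v) = toN (a *: v).
Proof.
by apply/toN_eq; rewrite -scalerBr memvZ //; apply/toN_eq; rewrite toN_repr.
Qed.

Fact NscaleA a b x : Nscale a (Nscale b x) = Nscale (a * b) x.
Proof. by rewrite -[x]toN_repr !NscaleE scalerA. Qed.
Fact Nscale1 : left_id 1 Nscale.
Proof. by move=> x; rewrite -[x]toN_repr !NscaleE scale1r. Qed.
Fact NscaleDr : right_distributive Nscale +%R.
Proof.
move=> a x y; rewrite -[x]toN_repr -[y]toN_repr.
by rewrite -toND !NscaleE scalerDr toND.
Qed.
Fact NscaleDl x : {morph Nscale^~ x : a b / a + b}.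
Proof. by move=> a b; rewrite -[x]toN_repr !NscaleE scalerDl toND. Qed.

HB.instance Definition _ := GRing.Zmodule_isLmodule.Build R Nspace
  NscaleA Nscale1 NscaleDr NscaleDl.

Fact toN_is_linear : linear toN.
Proof. by move=> a u v; rewrite toND -NscaleE. Qed.

HB.instance Definition _ :=
  GRing.isLinear.Build R 'rV[R]_n Nspace _ toN toN_is_linear.

Let B := col_base (cokermx (const_mx 1 : 'rV[R]_n)).

Let diagonalE v : (v \in diagonal) = (v *m B == 0).
Proof.
have -> : (v *m B == 0) = (v *m cokermx (const_mx 1 : 'rV[R]_n) == 0).
  have -> : v *m cokermx (const_mx 1 : 'rV[R]_n) =
            v *m B *m row_base (cokermx (const_mx 1 : 'rV[R]_n)).
    by rewrite -mulmxA mulmx_base.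
  apply/eqP/eqP => [->|vB]; first by rewrite mul0mx.
  by apply: (row_free_inj (row_base_free _)); rewrite vB mul0mx.
rewrite -submxE; apply/vlineP/sub_rVP => -[k ->]; by exists k.
Qed.

Fact Nspace_vect : Vector.axiom (\rank (cokermx (const_mx 1 : 'rV[R]_n))) Nspace.
Proof.
pose q (x : Nspace) := repr x *m B.
have qE v : q (toN v) = v *m B.
  by apply/eqP; rewrite -subr_eq0 -mulmxBl -diagonalE; apply/toN_eq/toN_repr.
exists q => [a x y|].
  rewrite -[x in LHS]toN_repr -[y in LHS]toN_repr -linearP qE.
  by rewrite mulmxDl -scalemxAl.
exists (fun r => toN (r *m pinvmx B)) => [x|r]; last first.
  rewrite qE mulmxKpV // submx_full //.
  exact: col_base_full.
rewrite -[RHS]toN_repr; apply/toN_eq; rewrite diagonalE mulmxBl subr_eq0.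
by rewrite mulmxKpV // submxMl.
Qed.

HB.instance Definition _ := Lmodule_hasFinDim.Build R Nspace Nspace_vect.

Definition indicator (S : {set 'I_n}) : 'rV[R]_n := \row_i (i \in S)%:R.

Definition e_ (S : {set 'I_n}) : Nspace * Nspace := (toN (indicator S), 0).
Definition f_ (S : {set 'I_n}) : Nspace * Nspace := (0, toN (indicator S)).

End Nspace.

Local Open Scope classical_set_scope.

Section Cones.
Variables (R : realFieldType) (V : vectType R).

Definition cone (gs : seq V) : set V :=
  [set v | exists2 c : 'I_(size gs) -> R,
     (forall i, 0 <= c i) & v = \sum_i c i *: gs`_i].

(* The whole cone is the face cut out by u = 0. *)
Definition is_face (F C : set V) : Prop :=
  exists2 u : {scalar V}, (forall v, C v -> 0 <= u v) &
    F = C `&` [set v | u v = 0].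

Definition is_linear_span (C : set V) (U : {vspace V}) : Prop :=
  (forall v, C v -> v \in U) /\
  (forall W : {vspace V}, (forall v, C v -> v \in W) -> (U <= W)%VS).

Definition has_dim (C : set V) (i : nat) : Prop :=
  exists2 U : {vspace V}, is_linear_span C U & \dim U = i.

End Cones.

Definition bipermutation (n : nat) (b : seq 'I_n) : Prop :=
  size b = (2 * n - 1)%N /\
  exists k : 'I_n, count_mem k b = 1%N /\
    forall j : 'I_n, j != k -> count_mem j b = 2%N.

Section BipermutahedralFan.
Variables (R : realFieldType) (n : nat).

Definition bip_ray (b : seq 'I_n) (m : nat) : Nspace R n * Nspace R n :=
  e_ R [set x in take m b] + f_ R [set x in drop m b].

Definition bip_cone (b : seq 'I_n) : set (Nspace R n * Nspace R n) :=
  cone [seq bip_ray b m | m <- iota 1 (2 * n - 2)].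

Definition bip_fan : set (set (Nspace R n * Nspace R n)) :=
  [set C | exists2 b : seq 'I_n, bipermutation b & is_face C (bip_cone b)].

(* [fset_set] sends a finite set to the corresponding {fset _}; bip_fan is
   finite, since there are finitely many bipermutations of [n] and each
   bip_cone is polyhedral. *)
Definition fnum (i : nat) : nat :=
  #|` fset_set [set C | bip_fan C /\ has_dim C i] |.

End BipermutahedralFan.

(* Main.v *)
(* A point (x, y) of N_n x N_n has a lift, unique up to adding (c, -c), with
   min_j (x_j + y_j) = 0; reading off the order of the numbers -x_j <= y_j on
   the real line gives a bisequence B_0 | ... | B_i (nonempty blocks, every
   element in one or two blocks, some element in exactly one), and the cones of
   dimension i of the fan are the closures of the sets of points with a given
   bisequence of i+1 blocks.

   An element lying in the blocks p_j <= q_j is a possibly looped edge p_j q_j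
   on the set of blocks.  Sorting the n-tuples of edges on m vertices with at
   least one loop by the set of vertices they cover gives
     sum_k C(m, k) b_k = C(m+1, 2)^n - C(m, 2)^n,
   where b_k is the number of bisequences with k blocks.  By Pascal's rule this
   telescopes to sum_k C(d, k) b_(k-1) = C(d, 2)^n, which is the identity of
   coefficients obtained after multiplying the theorem by e^x. *)
Require Import Defs.
From HB Require Import structures.
From mathcomp Require Import all_boot all_order all_algebra.
From mathcomp Require Import finmap zify.
From mathcomp Require Import boolp classical_sets functions cardinality reals.

Set Implicit Arguments.
Unset Strict Implicit.
Unset Printing Implicit Defensive.

Import Order.TTheory GRing.Theory Num.Theory.
Local Open Scope ring_scope.

(** * Simplicial cones: dimension and faces *)

Section SimplicialCones.
Variables (R : realFieldType) (V : vectType R).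
Implicit Types (gs : seq V) (F C : set V).

(** Coefficients attached to vectors rather than to positions carry over unchanged to a subsequence
    of the generators. *)
Lemma coneP gs v : uniq gs ->
  cone gs v <-> exists2 c : V -> R, (forall g, 0 <= c g) &
                                     v = \sum_(g <- gs) c g *: g.
Proof.
move=> gsU; split=> [[c c0 ->]|[c c0 ->]]; last first.
  exists (fun i => c gs`_i) => [i|]; first exact: c0.
  by rewrite (big_nth 0) big_mkord.
exists (fun g => if insub (index g gs) is Some i then c i else 0) => [g|].
  by case: insubP.
rewrite (big_nth 0) big_mkord; apply: eq_bigr => i _.
by rewrite index_uniq // valK.
Qed.

Lemma cone_gen gs g : uniq gs -> g \in gs -> cone gs g.
Proof.
move=> gsU gi; apply/(coneP _ gsU); exists (fun h => (h == g)%:R).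
  by move=> h; rewrite ler0n.
rewrite (bigD1_seq g) //= eqxx scale1r big1 ?addr0 // => h /negPf->.
by rewrite scale0r.
Qed.

Lemma has_dim_cone gs : free gs -> has_dim (cone gs) (size gs).
Proof.
move=> gsF; have gsU := free_uniq gsF.
exists <<gs>>%VS; last by apply/eqP.
split=> [v /(coneP _ gsU) [c _ ->]|W gsW].
  rewrite big_seq; apply: memv_suml => g gi.
  by rewrite memvZ // memv_span.
by apply/span_subvP => g gi; apply/gsW/cone_gen.
Qed.

Lemma has_dim_inj C i j : has_dim C i -> has_dim C j -> i = j.
Proof.
move=> [U [CU UW] <-] [U' [CU' UW'] <-].
by apply/eqP; rewrite eqn_leq !dimvS ?UW ?UW'.
Qed.

(** The functional is the sum of the dual coordinates of the generators outside [P]; it supports the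
    face spanned by those in [P]. *)
Lemma free_separating gs (P : pred V) : free gs ->
  exists u : {scalar V}, {in gs, forall g, u g = (~~ P g)%:R}.
Proof.
move=> gsF; pose X := in_tuple gs; have XF : free X := gsF.
pose f (v : V) : R^o := \sum_(i < size gs | ~~ P gs`_i) coord X i v.
have lf : linear f.
  move=> a x y; rewrite /f scaler_sumr -big_split /=.
  by apply: eq_bigr => i _; rewrite linearP.
pose fL := GRing.isLinear.Build R V R^o _ f lf.
pose u : {scalar V} := HB.pack f fL.
exists u => g gi; rewrite /u /= /f.
have gs_g : (index g gs < size gs)%N by rewrite index_mem.
pose k := Ordinal gs_g.
have gE : g = X`_k by rewrite /= nth_index.
under eq_bigr => i _ do rewrite [in coord _ _ _]gE (coord_free k i XF).
case: (boolP (P g)) => Pg.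
  rewrite big1 // => i; case: eqVneq => // <-.
  by rewrite /= nth_index // Pg.
rewrite (bigD1 k) /= ?nth_index // eqxx big1 ?addr0 // => i /andP[_ /negPf].
by rewrite eq_sym => ->.
Qed.

(** A functional that is nonnegative on the generators kills a nonnegative combination only if it
    kills every term, so a face is spanned by the generators on which the functional vanishes.
    Recording them as a bit mask prepares the use of [merged]. *)
Lemma is_faceP gs F : free gs ->
  is_face F (cone gs) <->
  exists2 bm : bitseq, size bm = size gs & F = cone (mask bm gs).
Proof.
move=> gsF; have gsU := free_uniq gsF.
suff faceP : is_face F (cone gs) <->
    exists P : pred V, F = cone [seq g <- gs | P g].
  split=> [/faceP [P ->]|[bm _ FE]].
    by exists (map P gs); rewrite ?size_map // filter_mask.
  apply/faceP; exists (mem (mask bm gs)); rewrite FE.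
  by rewrite -(subseq_uniqP gsU _) // mask_subseq.
have fU P : uniq [seq g <- gs | P g] by rewrite filter_uniq.
split=> [[u u0 ->]|[P ->]]; last first.
  have [u uE] := free_separating P gsF; exists u.
    move=> v /(coneP _ gsU) [c c0 ->]; rewrite linear_sum big_seq sumr_ge0 //.
    by move=> g gi; rewrite linearZ /= mulr_ge0 // uE.
  apply/seteqP; split=> v /=.
    move=> /(coneP _ (fU P)) [c c0 ->]; split; last first.
      rewrite linear_sum big_filter big_seq_cond big1 // => g /andP[gi Pg].
      by rewrite linearZ /= uE // Pg mulr0.
    apply/(coneP _ gsU); exists (fun g => if P g then c g else 0) => [g|].
      by case: ifP.
    rewrite big_filter big_mkcond; apply: eq_bigr => g _.
    by case: ifP; rewrite ?scale0r.
  move=> [/(coneP _ gsU) [c c0 ->] uv]; apply/(coneP _ (fU P)).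
  exists c => //; rewrite big_filter [RHS]big_mkcond; apply: eq_big_seq => g gi.
  case: ifPn => // Pg; move: uv; rewrite linear_sum big_seq => /eqP.
  rewrite psumr_eq0 => [/allP /(_ g gi)|h hi]; last first.
    by rewrite linearZ /= mulr_ge0 // uE.
  by rewrite gi linearZ /= uE // Pg mulr1 => /eqP ->; rewrite scale0r.
exists (fun g => u g == 0); apply/seteqP; split=> v /=.
  move=> [/(coneP _ gsU) [c c0 ->] uv]; apply/(coneP _ (fU _)).
  exists c => //; rewrite big_filter [RHS]big_mkcond; apply: eq_big_seq => g gi.
  case: ifPn => // ug; move: uv; rewrite linear_sum big_seq => /eqP.
  rewrite psumr_eq0 => [/allP /(_ g gi)|h hi]; last first.
    by rewrite linearZ /= mulr_ge0 // u0 //; apply: cone_gen.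
  rewrite gi linearZ /= mulf_eq0 (negPf ug) orbF => /eqP ->.
  by rewrite scale0r.
move=> /(coneP _ (fU _)) [c c0 ->]; split; last first.
  rewrite linear_sum big_filter big1 // => g /eqP ug.
  by rewrite linearZ /= ug mulr0.
apply/(coneP _ gsU); exists (fun g => if u g == 0 then c g else 0) => [g|].
  by case: ifP.
rewrite big_filter big_mkcond; apply: eq_bigr => g _.
by case: ifP; rewrite ?scale0r.
Qed.

End SimplicialCones.

(** * Bisequences and the merging of consecutive blocks *)

Section Bisequences.
Variable n : nat.
Implicit Types (m k : nat) (p q : 'I_n -> nat) (bm : bitseq).

(* The bisequence B_0 | ... | B_(m-1), encoded by the positions p j <= q j of
   the first and last blocks containing j. *)
Record bisequence m p q : Prop := Bisequence {
  bisequence_le : forall j, (p j <= q j)%N;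
  bisequence_lt : forall j, (q j < m)%N;
  bisequence_single : exists j, p j = q j;
  bisequence_onto : forall k, (k < m)%N -> exists j, p j = k \/ q j = k }.

Lemma bisequence_gt0 m p q : bisequence m p q -> (0 < m)%N.
Proof. by move=> [_ lt [j _] _]; apply: leq_trans (lt j). Qed.

(* [merged bm] glues the consecutive blocks k and k+1 whenever bm`_k = false. *)
Definition merged bm k := count id (take k bm).

Lemma merged_le bm k l : (k <= l)%N -> (merged bm k <= merged bm l)%N.
Proof.
move=> kl; rewrite /merged -(subnKC kl) takeD count_cat; exact: leq_addr.
Qed.

Lemma mergedS bm k : merged bm k.+1 = (merged bm k + nth false bm k)%N.
Proof.
rewrite /merged; case: (ltnP k (size bm)) => kb.
  by rewrite (take_nth false kb) -cats1 count_cat /= addn0.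
by rewrite !take_oversize ?(leqW kb) // nth_default // addn0.
Qed.

Lemma merged_size bm : merged bm (size bm) = count id bm.
Proof. by rewrite /merged take_size. Qed.

(** [merged bm] starts at 0 and climbs by at most one at a time, so it skips no value. *)
Lemma merged_onto bm k : (k <= count id bm)%N ->
  exists2 l, (l <= size bm)%N & merged bm l = k.
Proof.
rewrite -merged_size; elim: (size bm) => [|s IHs].
  by rewrite {1}/merged take0 leqn0 => /eqP ->; exists 0%N; rewrite ?/merged ?take0.
move=> ks; have [/IHs [l ls <-]|sk] := leqP k (merged bm s).
  by exists l => //; apply: leqW.
exists s.+1 => //; move: ks sk; rewrite mergedS; case: (nth _ _ _) => /=; lia.
Qed.

Lemma bisequence_merged m p q bm : bisequence m p q -> size bm = m.-1 ->
  bisequence (count id bm).+1 (merged bm \o p) (merged bm \o q).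
Proof.
move=> pq; have m0 := bisequence_gt0 pq; case: pq => le lt [j0 E] onto sbm.
split=> [j|j||k] /=.
- exact/merged_le.
- by rewrite ltnS -merged_size merged_le // sbm; have := lt j; lia.
- by exists j0; rewrite E.
rewrite ltnS => /merged_onto [l ls <-].
have /onto [j [<-|<-]] : (l < m)%N by lia.
  by exists j; left.
by exists j; right.
Qed.

(** The boundary [k] between blocks [k-1] and [k] is governed by bit [k-1]. Since [merged bm k]
    counts the kept boundaries up to [k], it renumbers them consecutively from 1. *)
Lemma map_merged_mask bm :
  [seq merged bm k | k <- mask bm (iota 1 (size bm))] = iota 1 (count id bm).
Proof.
elim/last_ind: bm => // bm b IH.
rewrite size_rcons -[(size bm).+1]addn1 iotaD -[iota (1 + _) 1]/[:: (1 + size bm)%N] cats1.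
rewrite mask_rcons ?size_iota // map_cat.
rewrite -[in rcons bm b]cats1 count_cat iotaD -IH; congr cat.
  apply/eq_in_map => k /mem_mask; rewrite mem_iota => /andP[_ kb].
  rewrite /merged takel_cat // -ltnS.
case: b => //=; rewrite add1n mergedS /merged take_size_cat //.
by rewrite nth_cat ltnn subnn addn1.
Qed.

End Bisequences.

(** * The rays of a bisequence and the cone they span *)

Section Rays.
Variables (R : realFieldType) (n : nat).
Implicit Types (p q : 'I_n -> nat) (m k : nat) (c : nat -> R).

(** For a bipermutation this is [bip_ray], with prefix and suffix described through first and last
    occurrences. *)
Definition ray p q k : Nspace R n * Nspace R n :=
  e_ R [set j | p j < k]%N + f_ R [set j | k <= q j]%N.

Definition rays p q m := [seq ray p q k | k <- iota 1 m.-1].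

Lemma size_rays p q m : size (rays p q m) = m.-1.
Proof. by rewrite size_map size_iota. Qed.

(** A ray depends only on which blocks lie on each side of its boundary, and deleting other
    boundaries does not change that. *)
Lemma mask_rays p q m bm : size bm = m.-1 ->
  mask bm (rays p q m) = rays (merged bm \o p) (merged bm \o q) (count id bm).+1.
Proof.
move=> sbm; rewrite /rays -map_mask -sbm -map_merged_mask -map_comp.
apply/eq_in_map => k kin /=.
have bk : nth false bm k.-1 /\ (0 < k)%N.
  have [i ib bi] : exists2 i, (i < size bm)%N & (k = i.+1) /\ nth false bm i.
    have : k \in [seq k <- iota 1 (size bm) | nth false bm k.-1].
      rewrite filter_mask.
      rewrite (_ : [seq _ | _ <- _] = bm) //.
      apply: (@eq_from_nth _ false); rewrite ?size_map ?size_iota // => i ib.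
      by rewrite (nth_map 0%N) ?size_iota //= nth_iota // add1n.
    rewrite mem_filter mem_iota => /andP[bk /andP[k0 ks]].
    by exists k.-1; [lia | split => //; lia].
  by case: bi => ->.
case: k kin bk => [|k] _ [] //= bk _.
(* The boundary [k.+1] is kept, so [merged] steps up there and detects on which side of it a block
   lies. *)
have mk l : (l <= k)%N = (merged bm l < merged bm k.+1)%N.
  rewrite mergedS bk addn1 ltnS; case: (leqP l k) => [/merged_le ->//|kl].
  by have := merged_le bm kl; rewrite mergedS bk; lia.
congr (e_ _ _ + f_ _ _); apply/setP => j; rewrite !inE /=.
  by rewrite ltnS mk.
by rewrite ltnNge mk -leqNgt.
Qed.

(** The coefficients are the gaps between consecutive blocks on the real line, and [t] gives the
    resulting block positions. *)
Lemma sum_rays p q m c :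
  (forall j, p j < m)%N -> (forall j, q j < m)%N ->
  let t i := \sum_(1 <= k < i.+1) c k in
  \sum_(1 <= k < m) c k *: ray p q k =
  (toN (\row_j - t (p j)), toN (\row_j t (q j))).
Proof.
move=> pm qm t.
have sumE d1 d2 P : (d1 <= d2 < m)%N -> 
    (forall k, (1 <= k < m)%N -> P k = (d1 < k <= d2)%N) ->
    \sum_(1 <= k < m) c k * (P k)%:R = t d2 - t d1.
  move=> /andP[d12 dm] PE; rewrite /t.
  rewrite (big_cat_nat (n := d1.+1)) //=; last by lia.
  rewrite [X in _ + X](big_cat_nat (n := d2.+1)) //=.
  rewrite [X in _ = X - _](big_cat_nat (n := d1.+1)) //= addrAC subrr add0r.
  rewrite [X in X + _]big_nat [X in X + _]big1 => [|k kd]; last first.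
    have E : (d1 < k <= d2)%N = false by lia.
    by rewrite PE ?E ?mulr0 //; lia.
  rewrite [X in _ + (_ + X)]big_nat [X in _ + (_ + X)]big1 => [|k kd]; last first.
    have E : (d1 < k <= d2)%N = false by lia.
    by rewrite PE ?E ?mulr0 //; lia.
  rewrite add0r addr0; apply: eq_big_nat => k kd.
  have E : (d1 < k <= d2)%N = true by lia.
  by rewrite PE ?E ?mulr1 //; lia.
have t0 : t 0%N = 0 by rewrite /t big_geq.
rewrite [LHS]surjective_pairing; congr pair.
  rewrite (big_morph (fun v => v.1) (id1 := 0) (op1 := +%R)) //.
  under eq_bigr => k _ do rewrite /ray /= addr0 -linearZ /=.
  (* The boundaries after block [p j] contribute [t m.-1 - t (p j)]; the constant [t m.-1] dies
     modulo the diagonal. *)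
  rewrite -linear_sum; apply/toN_eq/vlineP; exists (t m.-1).
  apply/rowP => j; rewrite !mxE opprK summxE.
  under eq_bigr => k _ do rewrite !mxE !inE.
  rewrite (sumE (p j) m.-1) ?subrK ?mulr1 //.
    by have := pm j; lia.
  by move=> k; lia.
rewrite (big_morph (fun v => v.2) (id1 := 0) (op1 := +%R)) //.
under eq_bigr => k _ do rewrite /ray /= add0r -linearZ /=.
rewrite -linear_sum; congr toN.
apply/rowP => j; rewrite !mxE summxE.
under eq_bigr => k _ do rewrite !mxE !inE.
rewrite (sumE 0%N (q j)) ?t0 ?subr0 ?qm // => k; lia.
Qed.

Lemma toN_row_eq (x y : 'I_n -> R) :
  toN (\row_j x j) = toN (\row_j y j) ->
  exists a, forall j, x j = y j + a.
Proof.
move/toN_eq/vlineP => [a /rowP xy]; exists a => j.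
by have := xy j; rewrite !mxE mulr1 => <-; rewrite addrCA subrr addr0.
Qed.

(** If a combination vanishes, [t] is constant on the values of [p] and on those of [q]. The element
    with [p j0 = q j0] identifies the two constants, and every block is such a value, so all gaps
    are zero. *)
Lemma free_rays m p q : bisequence m p q -> free (rays p q m).
Proof.
move=> pq; have m0 := bisequence_gt0 pq; case: pq => le lt [j0 E] onto.
have ltp j : (p j < m)%N by apply: leq_ltn_trans (le j) (lt j).
suff c0 c : \sum_(1 <= k < m) c k *: ray p q k = 0 ->
    forall k, (1 <= k < m)%N -> c k = 0.
  apply/(freeP (X := in_tuple _)) => d d0 [i im].
  (* Generators are indexed from 0 but boundaries from 1, hence the shift. *)
  pose c k := if insub k.-1 is Some i then d i else 0.
  have := c0 c _ i.+1; rewrite /c insubT /=; apply; last first.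
    by move: im; rewrite size_rays; lia.
  rewrite -[RHS]d0 big_add1 -[X in \sum_(_ <= _ < X) _](size_rays p q m).
  rewrite big_mkord; apply: eq_bigr => /= l _.
  have lm : (l < m.-1)%N by rewrite -(size_rays p q m).
  rewrite /c /= valK; congr (_ *: _).
  by rewrite (nth_map 0%N) ?size_iota // nth_iota // add1n.
rewrite sum_rays // => -[]; set t := fun i => \sum_(1 <= k < i.+1) c k.
have <- : toN (\row_j 0 : 'rV[R]_n) = 0.
  by rewrite [X in toN X](_ : _ = 0) ?linear0 //; apply/rowP => j; rewrite !mxE.
move=> /toN_row_eq [a pa] /toN_row_eq [b qb].
have tq j : t (q j) = b by have := qb j; rewrite add0r.
have tp j : t (p j) = - a by have := pa j; rewrite add0r => <-; rewrite opprK.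
have tb k : (k < m)%N -> t k = b.
  by move=> /onto [j [<-|<-]] //; rewrite tp -(tp j0) E.
move=> k /andP[k0 km]; have: t k = t k.-1 by rewrite !tb //; lia.
rewrite /t prednK // big_nat_recr //= => /eqP.
by rewrite eq_sym addrC -subr_eq subrr eq_sym => /eqP.
Qed.

(** For the bound [s k <= k], by induction: the value [k+1] is attained at some [l], and [l <= k]
    would force it to be at most [k]. The opposite bound is the same one for the reversed
    sequence. *)
Lemma nondecreasing_onto_id m (s : nat -> R) :
  (forall k l, (k <= l < m)%N -> s k <= s l) ->
  (forall l, (l < m)%N -> exists2 k, (k < m)%N & s k = l%:R) ->
  forall k, (k < m)%N -> s k = k%:R.
Proof.
have le_id (u : nat -> R) :
    (forall k l, (k <= l < m)%N -> u k <= u l) ->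
    (forall l, (l < m)%N -> exists2 k, (k < m)%N & u k = l%:R) ->
    forall k, (k < m)%N -> u k <= k%:R.
  move=> umon uonto; elim=> [|k IHk] km; have [l lm ul] := uonto _ km.
    by rewrite -ul umon ?lm.
  have [lk|kl] := leqP l k; last by rewrite -ul umon ?kl.
  have: u l <= k%:R by apply: le_trans (IHk (ltnW km)); rewrite umon // lk ltnW.
  by rewrite ul ler_nat ltnn.
move=> smon sonto k km; apply/eqP; rewrite eq_le le_id //=.
have := le_id (fun i => m.-1%:R - s (m.-1 - i)%N) _ _ (m.-1 - k)%N.
rewrite natrB ?subKn; [|lia..]; rewrite lerD2l lerN2; apply; last by lia.
  by move=> i l il; rewrite lerD2l lerN2 smon //; lia.
move=> l lm; have [i im si] : exists2 k, (k < m)%N & s k = (m.-1 - l)%:R.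
  by apply: sonto; lia.
exists (m.-1 - i)%N; first by lia.
rewrite subKn; last by lia.
by rewrite si natrB; [rewrite opprB addrC subrK | lia].
Qed.

(* The point with all coefficients 1 has p j and q j as coordinates, up to a
   translation, so it determines (p, q) inside any cone of the same size. *)
Lemma cone_rays_inj m p q p' q' :
  bisequence m p q -> bisequence m p' q' ->
  cone (rays p q m) = cone (rays p' q' m) -> p =1 p' /\ q =1 q'.
Proof.
move=> pq pq' CE; have gsF := free_rays pq; have gsF' := free_rays pq'.
case: pq pq' => le lt [j0 E] onto [le' lt' [j1 E'] onto'].
have ltp j : (p j < m)%N by apply: leq_ltn_trans (le j) (lt j).
have ltp' j : (p' j < m)%N by apply: leq_ltn_trans (le' j) (lt' j).
have: cone (rays p q m) (\sum_(1 <= k < m) (fun=> 1) k *: ray p q k).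
  apply/(coneP _ (free_uniq gsF)); exists (fun=> 1) => [_|]; first exact: ler01.
  by rewrite big_map /index_iota subn1.
rewrite CE => /(coneP _ (free_uniq gsF')) [c' c'0]; rewrite big_map.
pose c k := c' (ray p' q' k).
rewrite -[m.-1]subn1 -[iota _ _]/(index_iota 1 m).
rewrite (sum_rays _ ltp lt) (sum_rays c ltp' lt').
set t := fun i => \sum_(1 <= k < i.+1) c k.
have tmon k l : (k <= l)%N -> t k <= t l.
  move=> kl; rewrite /t [leRHS](big_cat_nat (n := k.+1)) //= lerDl.
  by apply: sumr_ge0 => i _; apply: c'0.
have oneE k : \sum_(1 <= i < k.+1) 1 = k%:R :> R.
  by rewrite big_const_nat iter_addr addr0 subn1.
move=> [] /toN_row_eq [a pa] /toN_row_eq [b qb].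
have {}pa j : t (p' j) = (p j)%:R + a.
  move: (pa j); rewrite oneE => /eqP; rewrite eqr_oppLR opprD opprK => /eqP ->.
  by rewrite subrK.
have {}qb j : t (q' j) = (q j)%:R - b.
  by move: (qb j); rewrite oneE => ->; rewrite addrK.
(* An element in a single block of the first bisequence gives [a <= - b]; one in a single block of
   the second gives the converse. *)
have ab : a = - b.
  apply/eqP; rewrite eq_le; apply/andP; split.
    have := tmon _ _ (le' j0); rewrite pa qb E lerD2l //.
  rewrite -(lerD2l (p j1)%:R) -pa E' qb lerD2r ler_nat //.
have tE k : (k < m)%N -> t k - a = k%:R.
  apply: (nondecreasing_onto_id (m := m) (s := fun k => t k - a))
    => [{}k l /andP[kl _]|l /onto [j [<-|<-]]].
  - by rewrite lerD2r tmon.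
  - by exists (p' j); rewrite // pa addrK.
  - by exists (q' j); rewrite // qb ab addrK.
split=> j; apply/eqP; rewrite -(eqr_nat R).
  by rewrite -(tE (p' j)) ?pa ?addrK.
by rewrite -(tE (q' j)) ?qb ?ab ?addrK.
Qed.

End Rays.

(** * Bipermutations as bisequences, and the cones of the fan *)

Section Bipermutations.
Variable n : nat.
Implicit Types (b : seq 'I_n) (p q : 'I_n -> nat) (i k m : nat).

Definition last_index b j := ((size b).-1 - index j (rev b))%N.

Lemma mem_drop_last b j k : j \in b -> (j \in drop k b) = (k <= last_index b j)%N.
Proof.
move=> jb; have: (index j (rev b) < size b)%N.
  by rewrite -(size_rev b) index_mem mem_rev.
rewrite -[b in drop k b]revK drop_rev mem_rev in_take ?mem_rev // size_rev.
by rewrite /last_index; lia.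
Qed.

Lemma index_nth_bounds j0 b i : (i < size b)%N ->
  (index (nth j0 b i) b <= i <= last_index b (nth j0 b i))%N.
Proof.
move=> ib; rewrite -mem_drop_last ?mem_nth // -ltnS -in_take ?mem_nth //.
rewrite (take_nth j0 ib) mem_rcons mem_head.
by rewrite (drop_nth j0 ib) mem_head.
Qed.

Lemma last_index_ltn b j : j \in b -> (last_index b j < size b)%N.
Proof. by case: b => // x b _; rewrite /last_index ltnS leq_subr. Qed.

Lemma nth_last_index j0 b j : j \in b -> nth j0 b (last_index b j) = j.
Proof.
move=> jb; have: (index j (rev b) < size (rev b))%N by rewrite index_mem mem_rev.
move=> jr; rewrite -[RHS](nth_index j0 (s := rev b)) ?mem_rev //.
rewrite nth_rev -?(size_rev b) //; congr nth.
by rewrite /last_index size_rev; lia.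
Qed.

Lemma bipermutation_count b j : bipermutation b ->
  (0 < count_mem j b <= 2)%N.
Proof.
by move=> [_ [k [k1 k2]]]; case: (eqVneq j k) => [->|/k2 ->]; rewrite ?k1.
Qed.

Lemma bipermutation_mem b j : bipermutation b -> j \in b.
Proof. by move=> /bipermutation_count-/(_ j)/andP[]; rewrite -has_count has_pred1. Qed.

Lemma bisequence_bipermutation b : bipermutation b ->
  bisequence (size b) (fun j => index j b) (last_index b).
Proof.
move=> bB; have bj j := bipermutation_mem j bB.
have single j i : (i < size b)%N -> nth j b i = j ->
    count_mem j b = (count_mem j (take i b) + 1 + count_mem j (drop i.+1 b))%N.
  move=> ib bi; rewrite -{1}(cat_take_drop i b) (drop_nth j ib) bi count_cat /=.
  by rewrite eqxx addnA.
have notin j s : count_mem j s = 0%N -> j \notin s.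
  by move=> js; apply/count_memPn.
have le j : (index j b <= last_index b j)%N.
  by rewrite -mem_drop_last // drop_index // mem_head.
split=> // [j||i ib].
- exact: last_index_ltn.
- case: bB => _ [j [j1 _]]; exists j; apply/eqP; rewrite eqn_leq le /= leqNgt.
  rewrite -mem_drop_last //; apply: notin.
  have := single j (index j b); rewrite j1 index_mem.
  by move=> /(_ (bj j) (nth_index _ (bj j))); lia.
case: (bB) => _ [j0 _]; set j := nth j0 b i; exists j.
have ji : nth j b i = j by rewrite /j; apply: set_nth_default.
have /andP[jl jr] := index_nth_bounds j0 ib.
(* As [j] occurs at most twice, position [i] has no other occurrence before it or none after it, so
   it is the first or the last one. *)
have /andP[_] := bipermutation_count j bB; rewrite (single j i) // => cj.
have [c0|c0] := posnP (count_mem j (take i b)).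
  left; apply/eqP; rewrite eqn_leq jl /= leqNgt -in_take //; exact: notin.
right; apply/eqP; rewrite eqn_leq jr andbT leqNgt -mem_drop_last //.
by apply: notin; lia.
Qed.

Lemma bip_cone_rays (R : realFieldType) b : bipermutation b ->
  bip_cone (R := R) b = cone (rays R (fun j => index j b) (last_index b) (size b)).
Proof.
move=> bB; have bj j := bipermutation_mem j bB.
rewrite /bip_cone /rays; have -> : (size b).-1 = (2 * n - 2)%N.
  by case: bB => -> _; lia.
congr cone; apply: eq_map => k; rewrite /bip_ray /ray.
congr (e_ _ _ + f_ _ _); apply/setP => j; rewrite !inE.
  exact: in_take.
exact: mem_drop_last.
Qed.

(** Here [ks] lists the block of each position of a refinement; a boundary is kept exactly where the
    block changes. *)
Definition jumps (ks : seq nat) : bitseq :=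
  [seq nth 0%N ks i != nth 0%N ks i.+1 | i <- iota 0 (size ks).-1].

Lemma size_jumps ks : size (jumps ks) = (size ks).-1.
Proof. by rewrite size_map size_iota. Qed.

(** Such a list starts at 0 and rises by at most one at each step, so counting its rises returns its
    entries. *)
Lemma merged_jumps m ks : sorted leq ks -> (forall k, (k \in ks) = (k < m)%N) ->
  forall i, (i < size ks)%N -> merged (jumps ks) i = nth 0%N ks i.
Proof.
move=> kss ksm.
have mon i k : (i <= k < size ks)%N -> (nth 0%N ks i <= nth 0%N ks k)%N.
  move=> /andP[ik kk].
  by apply: (sorted_leq_nth leq_trans leqnn) => //; rewrite inE; lia.
have hit k : (k < m)%N -> exists2 i, (i < size ks)%N & nth 0%N ks i = k.
  rewrite -ksm => kk; exists (index k ks); first by rewrite index_mem.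
  exact: nth_index.
have ltm i : (i < size ks)%N -> (nth 0%N ks i < m)%N.
  by move=> ik; rewrite -ksm mem_nth.
elim=> [|i IHi] ik.
  have [|l lk l0] := hit 0%N; first by apply: leq_trans (ltm _ ik).
  by rewrite /merged take0 /=; have := mon 0%N l; rewrite l0; lia.
rewrite mergedS IHi 1?ltnW // (nth_map 0%N) ?size_iota; last by lia.
rewrite nth_iota ?add0n; last by lia.
have le1 := mon i i.+1; have lt := ltm _ ik.
suff : (nth 0%N ks i.+1 <= (nth 0%N ks i).+1)%N.
  by case: eqVneq => /=; lia.
(* A larger rise would skip a value, which by monotonicity could occur neither before nor after
   it. *)
rewrite leqNgt; apply/negP => lt1.
have [|l lk El] := hit (nth 0%N ks i).+1; first by lia.
have [li|il] := leqP l i; [have := mon l i|have := mon i.+1 l]; lia.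
Qed.

Lemma count_jumps m ks : (0 < m)%N -> sorted leq ks ->
  (forall k, (k \in ks) = (k < m)%N) -> count id (jumps ks) = m.-1.
Proof.
move=> m0 kss ksm; rewrite -merged_size size_jumps.
have: m.-1 \in ks by rewrite ksm; lia.
rewrite -index_mem => kx.
have k0 : ((size ks).-1 < size ks)%N by rewrite ltn_predL (leq_ltn_trans _ kx).
rewrite (merged_jumps kss ksm) //.
have lt : (nth 0%N ks (size ks).-1 < m)%N by rewrite -ksm mem_nth.
have : (nth 0%N ks (index m.-1 ks) <= nth 0%N ks (size ks).-1)%N.
  apply: (sorted_leq_nth leq_trans leqnn) => //.
  by move: kx; case: (size ks).
rewrite nth_index -?index_mem //; lia.
Qed.

(** * Refining a bisequence to a bipermutation *)

Section Refinement.
Variables (m : nat) (p q : 'I_n -> nat) (j0 : 'I_n).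
Hypothesis pq : bisequence m p q.
Hypothesis j0E : p j0 = q j0.

(** Every element other than [j0] is listed twice, even when [p j = q j], as a bipermutation
    requires. Only the block is sorted on: the order inside a block is irrelevant after merging. *)
Definition events : seq (nat * 'I_n) :=
  sort (relpre fst leq)
    ([seq (p j, j) | j <- enum 'I_n] ++
     [seq (q j, j) | j <- enum 'I_n & j != j0]).

Definition refinement : seq 'I_n := [seq e.2 | e <- events].

Lemma mem_events k j : ((k, j) \in events) = (k == p j) || (k == q j).
Proof.
rewrite mem_sort mem_cat; apply/orP/orP => -[].
- by move=> /mapP [i _ [-> ->]]; left.
- by move=> /mapP [i _ [-> ->]]; right.
- by move=> /eqP ->; left; rewrite map_f ?mem_enum.
move=> /eqP ->; have [->|jj0] := eqVneq j j0.
  by left; rewrite -j0E map_f ?mem_enum.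
by right; apply: map_f; rewrite mem_filter jj0 mem_enum.
Qed.

Lemma count_refinement j : count_mem j refinement = (1 + (j != j0))%N.
Proof.
have /permP -> : perm_eq refinement (enum 'I_n ++ [seq j <- enum 'I_n | j != j0]).
  rewrite (perm_trans (y := map snd ([seq (p j, j) | j <- enum 'I_n] ++
     [seq (q j, j) | j <- enum 'I_n & j != j0]))) //.
    by apply: perm_map; rewrite perm_sort.
  have sndK (f : 'I_n -> nat) s : map snd [seq (f l, l) | l <- s] = s.
    by elim: s => //= x s ->.
  by rewrite map_cat !sndK.
have enU : uniq (enum 'I_n) by exact: enum_uniq.
have fiU : uniq [seq i <- enum 'I_n | i != j0] by exact: filter_uniq.
rewrite count_cat (count_uniq_mem _ enU) (count_uniq_mem _ fiU).
by rewrite mem_filter mem_enum andbT.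
Qed.

Lemma size_refinement : size refinement = (2 * n - 1)%N.
Proof.
rewrite /refinement size_map size_sort size_cat.
rewrite (size_map (fun j => (p j, j))) (size_map (fun j => (q j, j))).
rewrite size_enum_ord size_filter.
have fE : count (fun j => j != j0) (enum 'I_n) = n.-1.
  have := count_predC (pred1 j0) (enum 'I_n); rewrite size_enum_ord.
  rewrite (count_uniq_mem _ (enum_uniq _)) mem_enum add1n.
  by move/(congr1 predn).
by rewrite fE; have := ltn_ord j0; lia.
Qed.

Lemma refinement_bipermutation : bipermutation refinement.
Proof.
split; first exact: size_refinement.
exists j0; rewrite count_refinement eqxx; split=> // j jj0.
by rewrite count_refinement jj0.
Qed.

Let ks := [seq e.1 | e <- events].

Let ks_sorted : sorted leq ks.
Proof. by rewrite /ks sorted_map sort_sorted // => x y; apply: leq_total. Qed.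

Let mem_ks k : (k \in ks) = (k < m)%N.
Proof.
have [le lt _ onto] := pq.
apply/mapP/idP => [[[l j]]|/onto [j jk]].
  rewrite mem_events => ljE /= ->; have := le j; have := lt j.
  by case/orP: ljE => /eqP ->; lia.
exists (k, j) => //; rewrite mem_events.
by case: jk => ->; rewrite eqxx ?orbT.
Qed.

Let nth_events i : (i < size events)%N ->
  (nth 0%N ks i, nth j0 refinement i) \in events.
Proof.
move=> ie; rewrite (nth_map (0%N, j0)) // (nth_map (0%N, j0)) //.
by rewrite -surjective_pairing mem_nth.
Qed.

Let ks_le i k : (i <= k < size events)%N -> (nth 0%N ks i <= nth 0%N ks k)%N.
Proof.
move=> /andP[ik kk].
by apply: (sorted_leq_nth leq_trans leqnn) => //; rewrite inE size_map; lia.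
Qed.

(** The first occurrence of [j] comes from block [p j] or [q j] and is no later than the event
    [(p j, j)]. Since the blocks are sorted and [p j <= q j], its block is [p j]. *)
Lemma merged_index j : merged (jumps ks) (index j refinement) = p j.
Proof.
have jr := bipermutation_mem j refinement_bipermutation.
have sE : size refinement = size events by rewrite size_map.
have je : (index j refinement < size events)%N by rewrite -sE index_mem.
rewrite (merged_jumps ks_sorted mem_ks) ?size_map //.
have := nth_events je; rewrite nth_index // mem_events => jE.
have ep : (p j, j) \in events by rewrite mem_events eqxx.
have pe : (index (p j, j) events < size events)%N by rewrite index_mem.
have := index_nth_bounds j0 (b := refinement) (i := index (p j, j) events).
rewrite sE pe (nth_map (0%N, j0)) // nth_index //= => /(_ isT) /andP[le _].
have := ks_le (i := index j refinement) (k := index (p j, j) events).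
have -> : nth 0%N ks (index (p j, j) events) = p j.
  by rewrite (nth_map (0%N, j0)) // nth_index.
rewrite le pe => /(_ isT).
by have := bisequence_le pq j; case/orP: jE => /eqP ->; lia.
Qed.

Lemma merged_last_index j : merged (jumps ks) (last_index refinement j) = q j.
Proof.
have jr := bipermutation_mem j refinement_bipermutation.
have sE : size refinement = size events by rewrite size_map.
have je : (last_index refinement j < size events)%N by rewrite -sE last_index_ltn.
rewrite (merged_jumps ks_sorted mem_ks) ?size_map //.
have := nth_events je; rewrite nth_last_index // mem_events => jE.
have eq : (q j, j) \in events by rewrite mem_events eqxx orbT.
have qe : (index (q j, j) events < size events)%N by rewrite index_mem.
have := index_nth_bounds j0 (b := refinement) (i := index (q j, j) events).
rewrite sE qe (nth_map (0%N, j0)) // nth_index //= => /(_ isT) /andP[_ le].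
have := ks_le (i := index (q j, j) events) (k := last_index refinement j).
have -> : nth 0%N ks (index (q j, j) events) = q j.
  by rewrite (nth_map (0%N, j0)) // nth_index.
rewrite le je => /(_ isT).
by have := bisequence_le pq j; case/orP: jE => /eqP ->; lia.
Qed.

Lemma bisequence_refinement : exists b bm,
  [/\ bipermutation b, size bm = (size b).-1, count id bm = m.-1,
      merged bm \o (fun j => index j b) =1 p & merged bm \o last_index b =1 q].
Proof.
exists refinement, (jumps ks); split.
- exact: refinement_bipermutation.
- by rewrite size_jumps !size_map.
- by rewrite (count_jumps (bisequence_gt0 pq) ks_sorted mem_ks).
- exact: merged_index.
- exact: merged_last_index.
Qed.

End Refinement.

(** A face of a maximal cone keeps some boundaries and merges blocks across the others; conversely a
    bisequence is a merging of its refinement. With [i.+1] blocks there are [i] boundaries, which is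
    the dimension. *)
Lemma bip_fan_rays (R : realFieldType) i :
  [set C | bip_fan (R := R) (n := n) C /\ has_dim C i]%classic =
  [set C | exists pq : ('I_n -> nat) * ('I_n -> nat),
     bisequence i.+1 pq.1 pq.2 /\ C = cone (rays R pq.1 pq.2 i.+1)]%classic.
Proof.
apply/seteqP; split=> C /=.
  move=> [[b bB]]; rewrite (bip_cone_rays R bB).
  have bS := bisequence_bipermutation bB.
  move=> /(is_faceP _ (free_rays R bS)) [bm]; rewrite size_rays => sbm.
  rewrite mask_rays // => ->; have bS' := bisequence_merged bS sbm.
  move/has_dim_inj => /(_ _ (has_dim_cone (free_rays R bS'))).
  by rewrite size_rays /= => ->; eexists (_, _); split; [exact: bS'|].
move=> [[p q] /= [pqB ->]]; split; last first.
  by have := has_dim_cone (free_rays R pqB); rewrite size_rays.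
have [j0 j0E] := bisequence_single pqB.
have [b [bm [bB sbm cbm bp bq]]] := bisequence_refinement pqB j0E.
exists b => //; rewrite (bip_cone_rays R bB).
apply/(is_faceP _ (free_rays R (bisequence_bipermutation bB))).
exists bm; rewrite ?size_rays // mask_rays // cbm /=.
by rewrite (funext bp) (funext bq).
Qed.

End Bipermutations.

(** * Counting bisequences *)

Section Counting.
Implicit Types (n m k d : nat).

Definition blocks n m (g : {ffun 'I_n -> 'I_m * 'I_m}) : {set 'I_m} :=
  [set k : 'I_m | [exists j, (k == (g j).1) || (k == (g j).2)]].

Definition looped n m : {set {ffun 'I_n -> 'I_m * 'I_m}} :=
  [set g : {ffun 'I_n -> 'I_m * 'I_m} | [forall j, (g j).1 <= (g j).2]%N &&
           [exists j, (g j).1 == (g j).2]].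

Definition bisequences n m : {set {ffun 'I_n -> 'I_m * 'I_m}} :=
  [set g in looped n m | blocks g == [set: 'I_m]].

Lemma bisequencesP n m (g : {ffun 'I_n -> 'I_m * 'I_m}) :
  g \in bisequences n m <->
  bisequence m (fun j => (g j).1 : nat) (fun j => (g j).2 : nat).
Proof.
rewrite !inE -andbA; split=> [/and3P[/forallP le /existsP [j0 /eqP E] /eqP onto]|].
  split=> // [|k km]; first by exists j0; rewrite E.
  have : Ordinal km \in blocks g by rewrite onto inE.
  by rewrite inE => /existsP [j jk]; exists j; case/orP: jk => /eqP <-; [left|right].
move=> [le _ [j0 E] onto]; apply/and3P; split.
- exact/forallP.
- by apply/existsP; exists j0; apply/eqP/val_inj.
apply/eqP/setP => k; rewrite !inE; apply/existsP.
have [j jk] := onto k (ltn_ord k); exists j; apply/orP.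
by case: jk => jk; [left|right]; rewrite -val_eqE /= jk.
Qed.

(** The cones are the injective image of a finite set, by [cone_rays_inj]. This also gives the
    finiteness under which [fset_set] returns the actual set. *)
Lemma fnum_bisequences (R : realFieldType) n i :
  fnum R n i = #|bisequences n i.+1|.
Proof.
pose K (g : {ffun 'I_n -> 'I_i.+1 * 'I_i.+1}) :=
  cone (rays R (fun j => (g j).1 : nat) (fun j => (g j).2 : nat) i.+1).
rewrite /fnum bip_fan_rays.
set A := (X in fset_set X).
have -> : A = [set` [fset K g | g in bisequences n i.+1]%fset]%classic.
  apply/seteqP; split=> C; rewrite /A /=.
    move=> [[p q] /= [pqB ->]]; have [le lt _ _] := pqB.
    pose g : {ffun 'I_n -> 'I_i.+1 * 'I_i.+1} :=
      [ffun j => (inord (p j), inord (q j))].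
    have gp : (fun j => (g j).1 : nat) = p.
      by apply/funext => j; rewrite ffunE /= inordK // (leq_ltn_trans (le j)).
    have gq : (fun j => (g j).2 : nat) = q.
      by apply/funext => j; rewrite ffunE /= inordK.
    apply/imfsetP; exists g; last by rewrite /K gp gq.
    by apply/bisequencesP; rewrite gp gq.
  move=> /imfsetP [g /= /bisequencesP gB ->].
  by exists ((fun j => (g j).1 : nat), (fun j => (g j).2 : nat)).
rewrite set_fsetK card_in_imfset /=; first by rewrite -sum1_size big_enum sum1_card.
move=> g h /bisequencesP gB /bisequencesP hB E.
have [E1 E2] := cone_rays_inj gB hB E.
apply/ffunP => j; rewrite [g j]surjective_pairing [h j]surjective_pairing.
by congr pair; apply/val_inj; [exact: E1 | exact: E2].
Qed.

Lemma card_lt_pairs m : #|[pred e : 'I_m * 'I_m | e.1 < e.2]%N| = 'C(m, 2).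
Proof.
rewrite -sum1_card -(pair_big_dep xpredT (fun i j : 'I_m => i < j)%N
  (fun _ _ => 1%N)) /=.
rewrite (exchange_big_dep xpredT) //= -bin2_sum big_mkord; apply: eq_bigr => j _.
by rewrite (big_ord_narrow (ltnW (ltn_ord j))) sum_nat_const card_ord muln1.
Qed.

Lemma card_le_pairs m : #|[pred e : 'I_m * 'I_m | e.1 <= e.2]%N| = 'C(m.+1, 2).
Proof.
rewrite binS bin1 -card_lt_pairs -(cardID [pred e | e.1 == e.2]) addnC; congr addn.
  by apply: eq_card => -[i j]; rewrite !inE /= ltn_neqAle.
rewrite -[RHS](card_ord m) -(fintype.card_image (f := fun i : 'I_m => (i, i)));
  last first.
  by move=> i j [].
apply: eq_card => -[i j]; rewrite !inE /=.
apply/andP/fintype.imageP => [[_ /eqP->]|[k _ [-> ->]]].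
  by exists j.
by rewrite leqnn eqxx.
Qed.

(** The tuples of weakly increasing pairs split into those with a loop and those whose pairs are all
    strict. *)
Lemma card_looped n m : (#|looped n m| + 'C(m, 2) ^ n = 'C(m.+1, 2) ^ n)%N.
Proof.
have cf (A : pred ('I_m * 'I_m)) : (#|A| ^ n =
    #|[pred g : {ffun 'I_n -> 'I_m * 'I_m} | g \in ffun_on A]|)%N.
  by rewrite -{1}(card_ord n) -card_ffun_on; apply: eq_card => g; rewrite inE.
rewrite -card_le_pairs -card_lt_pairs !cf.
pose lt := [pred g : {ffun 'I_n -> 'I_m * 'I_m} | [exists j, (g j).1 == (g j).2]].
rewrite -[RHS](cardID lt); congr addn; apply: eq_card => g; rewrite !inE.
  by rewrite andbC; congr andb; apply/forallP/ffun_onP => H j; have := H j; rewrite !inE.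
apply/ffun_onP/andP => [H|[/existsPn H1 /ffun_onP H2] j]; last first.
  by have := H1 j; have := H2 j; rewrite !inE ltn_neqAle => -> ->.
split; last by apply/ffun_onP => j; have := H j; rewrite !inE => /ltnW.
by apply/existsPn => j; have := H j; rewrite !inE ltn_neqAle => /andP[].
Qed.

(** Relabelling along the increasing enumeration [ev] of [S] preserves and reflects both the order
    in each pair and loops. *)
Lemma card_looped_blocks n m (S : {set 'I_m}) :
  #|[set g in looped n m | blocks g == S]| = #|bisequences n #|S| |.
Proof.
pose ev : 'I_#|S| -> 'I_m := @Order.enum_val _ _ (mem S).
have evle i j : (ev i <= ev j)%N = (i <= j)%N.
  by have := @Order.le_enum_val _ 'I_m (@le_total _ _) (mem S) i j; rewrite !leEord.
have evinj : injective ev.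
  by move=> i j E; apply/val_inj/eqP; rewrite eqn_leq -!evle E leqnn.
have evS i : ev i \in S by exact: Order.enum_valP.
have evonto x : x \in S -> exists i, x = ev i.
  by move=> xS; exists (Order.enum_rank_in xS x); rewrite /ev Order.enum_rankK_in.
pose Phi (g : {ffun 'I_n -> 'I_#|S| * 'I_#|S|}) : {ffun 'I_n -> 'I_m * 'I_m} :=
  [ffun j => (ev (g j).1, ev (g j).2)].
have PhiI : injective Phi.
  move=> g h /ffunP E; apply/ffunP => j; have := E j; rewrite !ffunE.
  by case: (g j) (h j) => [a b] [c d] /= [/evinj -> /evinj ->].
rewrite -(card_imset _ PhiI); apply: eq_card => h; apply/idP/imsetP.
  rewrite !inE => /andP[/andP[/forallP le /existsP[j0 E] /eqP hS]].
  have hS1 j : (h j).1 \in S.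
    by rewrite -hS inE; apply/existsP; exists j; rewrite eqxx.
  have hS2 j : (h j).2 \in S.
    by rewrite -hS inE; apply/existsP; exists j; rewrite eqxx orbT.
  have /choice [p pE] := fun j => evonto _ (hS1 j).
  have /choice [q qE] := fun j => evonto _ (hS2 j).
  exists [ffun j => (p j, q j)]; last first.
    by apply/ffunP => j; rewrite !ffunE /= -pE -qE -surjective_pairing.
  rewrite !inE -andbA; apply/and3P; split.
  - by apply/forallP => j; rewrite ffunE /= -evle -pE -qE.
  - by apply/existsP; exists j0; rewrite ffunE /= -(inj_eq evinj) -pE -qE.
  apply/eqP/setP => k; rewrite !inE; apply/existsP.
  have : ev k \in blocks h by rewrite hS.
  rewrite inE => /existsP [j].
  by rewrite pE qE !(inj_eq evinj) => jk; exists j; rewrite ffunE.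
move=> [g]; rewrite !inE => /andP[/andP[/forallP le /existsP [j0 E] /eqP gT]] ->.
apply/andP; split; first (apply/andP; split).
- by apply/forallP => j; rewrite ffunE /= evle.
- by apply/existsP; exists j0; rewrite ffunE /= (inj_eq evinj).
apply/eqP/setP => x; rewrite inE; apply/existsP/idP.
  by move=> [j]; rewrite ffunE /= => /orP[]/eqP->.
move=> /evonto [k ->]; have : k \in blocks g by rewrite gT inE.
rewrite inE => /existsP [j jk]; exists j.
by rewrite ffunE /= !(inj_eq evinj).
Qed.

Lemma sum_bisequences n m :
  (\sum_(k < m.+1) 'C(m, k) * #|bisequences n k| + 'C(m, 2) ^ n =
   'C(m.+1, 2) ^ n)%N.
Proof.
rewrite -card_looped; congr addn.
rewrite -sum1_card (partition_big (@blocks n m) xpredT) //=.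
have -> : (\sum_(S : {set 'I_m}) \sum_(g in looped n m | blocks g == S) 1 =
    \sum_(S : {set 'I_m}) #|bisequences n #|S| |)%N.
  apply: eq_bigr => S _; rewrite -card_looped_blocks -sum1_card.
  by apply: eq_bigl => g; rewrite !inE.
have cS (S : {set 'I_m}) : (#|S| < m.+1)%N.
  by rewrite ltnS -[m in (_ <= m)%N]card_ord max_card.
rewrite (partition_big (fun S => Ordinal (cS S)) xpredT) //=.
apply: eq_bigr => k _; rewrite -[m in 'C(m, _)]card_ord -card_draws.
rewrite -sum_nat_const; apply: eq_big => [S|S]; last by rewrite inE => /eqP ->.
by rewrite inE; apply/esym/val_eqE.
Qed.

Lemma bisequences0 n : (0 < n)%N -> #|bisequences n 0| = 0%N.
Proof.
move=> n0; apply: eq_card0 => g; case: (g (Ordinal n0)) => -[k km] _.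
by exfalso; move: km.
Qed.

Lemma sum_fnum (R : realFieldType) n d : (0 < n)%N ->
  (\sum_(k < d.+1) 'C(d, k) * (if 2 <= k then fnum R n (k - 2) else 0) =
   'C(d, 2) ^ n)%N.
Proof.
move=> n0.
(* Cones of dimension [k - 2] have [k - 1] blocks, so the index shifts by one; the term with no
   blocks vanishes. *)
have -> : (\sum_(k < d.+1) 'C(d, k) * (if 2 <= k then fnum R n (k - 2) else 0) =
    \sum_(k < d) 'C(d, k.+1) * #|bisequences n k|)%N.
  rewrite big_ord_recl muln0 add0n; apply: eq_bigr => -[[|k] kd] _ /=.
    by rewrite bisequences0.
  by rewrite fnum_bisequences /bump /= !subSS subn0.
(* The base case needs [0 < n], as the right side is a power of 0. In the inductive step Pascal's
   rule splits the sum into the one for [d] and the one in [sum_bisequences]. *)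
elim: d => [|d IHd]; first by rewrite big_ord0 exp0n.
rewrite -sum_bisequences -IHd.
under eq_bigr => k _ do rewrite binS mulnDl.
by rewrite big_split /= big_ord_recr /= bin_small // mul0n addn0 addnC.
Qed.

End Counting.

(** * Coefficients of the power series *)

Lemma fps_natrE (A : comNzRingType) (k n : nat) :
  (k%:R : fps A) n = if n is 0%N then k%:R else 0.
Proof.
elim: k => [|k IHk]; first by rewrite fps0E; case: n.
by rewrite -natr1 fpsDE fps1E IHk; case: {IHk} n => [|n]; rewrite ?natr1 ?addr0.
Qed.

(** The coefficients of e^x are inverses taken in Q[[y]]; as constant series they act by scalars. *)
Lemma fps_natrV (k : nat) : (0 < k)%N -> (k%:R : fps rat)^-1 = fpsC k%:R^-1.
Proof.
move=> k0; have kE : fpsC k%:R^-1 * k%:R = 1 :> fps rat.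
  apply: fpsP => n; rewrite fpsCME fps_natrE fps1E; case: n => [|n].
    by rewrite mulVf // pnatr_eq0 -lt0n.
  by rewrite mulr0.
have kU : (k%:R : fps rat) \is a GRing.unit.
  by apply/unitrP; exists (fpsC k%:R^-1); rewrite [k%:R * _]mulrC kE.
by apply: (mulIr kU); rewrite mulVr // kE.
Qed.

Lemma bin_factV (n i : nat) : (i <= n)%N ->
  'C(n, i)%:R / n`!%:R = i`!%:R^-1 / (n - i)`!%:R :> rat.
Proof.
move=> lein; have fN0 k : k`!%:R != 0 :> rat by rewrite pnatr_eq0 -lt0n fact_gt0.
by rewrite -(bin_fact lein) !natrM !invfM mulVKf // pnatr_eq0 -lt0n bin_gt0.
Qed.

(** The expansion of e^(ky); multiplying by one more e^y is the binomial formula for (k+1)^n. *)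
Lemma fps_exp_pow (k n : nat) : (fps_exp rat ^+ k) n = (k ^ n)%:R / n`!%:R.
Proof.
elim: k n => [|k IHk] n.
  rewrite expr0 fps1E; case: n => [|n]; first by rewrite divr1.
  by rewrite exp0n // mul0r.
rewrite exprSr fpsME -[k.+1]addn1 expnDn natr_sum mulr_suml.
rewrite [RHS](reindex_inj rev_ord_inj).
apply: eq_bigr => -[i /= lin] _; rewrite subSS exp1n muln1.
rewrite IHk /= subKn // natrM [RHS]mulrAC bin_sub // bin_factV //.
by rewrite [RHS]mulrC mulrA.
Qed.

Lemma eval_F_series (m n : nat) :
  fps_eval F_series (fps_exp rat) m n = ('C(m, 2) ^ n)%:R / m`!%:R / n`!%:R.
Proof.
have fN0 : (m`!%:R)^-1 != 0 :> rat by rewrite invr_eq0 pnatr_eq0 -lt0n fact_gt0.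
rewrite /fps_eval /F_series /= /map_poly horner_poly size_scale // size_polyXn.
(* Only the top coefficient of the scaled monomial is nonzero. *)
rewrite fps_sumE big_ord_recr big1 => [|i _].
  apply: etrans (add0r _) _.
  by rewrite fpsCME coefZ coefXn eqxx mulr1 fps_exp_pow mulrA [_^-1 * _]mulrC.
by rewrite fpsCME coefZ coefXn ltn_eqF ?ltn_ord //= mulr0 mul0r.
Qed.

Theorem theorem3p2 (R : realType) :
  1 + FPS (fun d : nat => FPS (fun n : nat =>
        if (1 <= n)%N && (2 <= d)%N
        then (fnum R n (d - 2))%:R / (d`!)%:R / (n`!)%:R
        else 0 : rat))
  = fps_eval F_series (fps_exp rat) / fps_exp (fps rat).
Proof.
have expU : fps_exp (fps rat) \is a GRing.unit.
  have : fps_exp (fps rat) 0%N \is a GRing.unit by rewrite /= invr1 unitr1.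
  by [].
apply: (canRL (mulrK expU)); apply: fpsP => d; apply: fpsP => n.
(* After multiplication by e^x, [G k] is the numerator of the coefficient of x^k y^n on the left; in
   degree [n = 0] it comes from the summand 1 alone. *)
pose G k := (if n is 0%N then (k == 0%N) : nat
             else if 2 <= k then fnum R n (k - 2) else 0)%N.
have sumG : (\sum_(k < d.+1) 'C(d, k) * G k = 'C(d, 2) ^ n)%N.
  rewrite /G; case: (n) => [|n']; last exact: sum_fnum.
  rewrite expn0 big_ord_recl bin0 big1 //= => i _; exact: muln0.
rewrite eval_F_series fpsME fps_sumE -sumG natr_sum !mulr_suml.
apply: eq_bigr => i _; have lid : (i <= d)%N by rewrite -ltnS.
rewrite -[fps_exp _ (d - i)%N]/((d - i)`!%:R^-1) fps_natrV ?fact_gt0 //.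
rewrite [X in coefs X n]mulrC fpsCME !fpsDE fps1E.
rewrite natrM [_ * (G i)%:R / _]mulrAC bin_factV //.
set L := (X in _ * X = _); have -> : L = (G i)%:R / i`!%:R / n`!%:R.
  rewrite /L /G /=; case: (n) => [|n'] /=.
    by case: (nat_of_ord i) => [|k]; rewrite /= addr0 ?mul0r ?divr1.
  rewrite (_ : coefs _ n'.+1 = 0) ?add0r; last by case: eqVneq.
  by case: ifP; rewrite ?mul0r.
by rewrite -!mulrA [RHS]mulrCA; congr (_ * _); apply: mulrCA.
Qed.
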